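(* Let $\kappa:\mathcal C\to\mathbb R$ be a continuous functional of degree at most two, and let $b_\kappa:\mathcal C\times\mathcal C\to\mathbb R$, $$b_\kappa(C,D)=2\kappa\left(\frac{C+D}{2}\right)-\frac{\kappa(C)+\kappa(D)}{2},$$ be its canonical polarization. Then the following properties hold. (i) $b_\kappa$ is jointly continuous, symmetric, and affine in each argument. (ii) $b_\kappa(C,C)=\kappa(C)$ for every $C\in\mathcal C$. (iii) For every $C,D\in\mathcal C$ and $t\in[0,1]$, $$\kappa((1-t)C+tD)=(1-t)^2\kappa(C)+2t(1-t)b_\kappa(C,D)+t^2\kappa(D).$$ (iv) $b_\kappa$ is the unique symmetric separately affine map on $\mathcal C\times\mathcal C$ whose diagonal $C\mapsto b_\kappa(C,C)$ is $\kappa$.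
   Context: $\mathcal C$ is the (convex) set of all bivariate copulas, with the uniform topology. $\kappa:\mathcal C\to\mathbb R$ has degree at most two if for every $C,D\in\mathcal C$ the map $t\mapsto\kappa((1-t)C+tD)$ agrees on $[0,1]$ with a real polynomial of degree at most two. A map $b:\mathcal C\times\mathcal C\to\mathbb R$ is jointly continuous if it is continuous with respect to the product uniform topology; it is separately affine if it is affine (preserves convex combinations) in each argument with the other one fixed. *)

(* Defs.v *)
From HB Require Import structures.
From mathcomp Require Import all_boot all_order all_algebra.
From mathcomp Require Import all_classical all_reals all_analysis.
From mathcomp Require Import ring lra.

Set Implicit Arguments.
Unset Strict Implicit.
Unset Printing Implicit Defensive.

Import Order.TTheory GRing.Theory Num.Theory.
Import numFieldNormedType.Exports.

Local Open Scope classical_set_scope.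
Local Open Scope ring_scope.
Local Open Scope convex_scope.

Definition is_copula (R : realType) (C : {i01 R} * {i01 R} -> R) : Prop :=
  [/\ forall x, 0 <= C x <= 1,
      forall u, C (u, 0%:i01) = 0 /\ C (0%:i01, u) = 0,
      forall u, C (u, 1%:i01) = u%:num /\ C (1%:i01, u) = u%:num &
      forall u1 u2 v1 v2 : {i01 R}, u1%:num <= u2%:num -> v1%:num <= v2%:num ->
        0 <= C (u2, v2) - C (u2, v1) - C (u1, v2) + C (u1, v1)].

Record copula (R : realType) := Copula {
  copula_fun :> {i01 R} * {i01 R} -> R ;
  copulaP : is_copula copula_fun }.

HB.instance Definition _ (R : realType) := gen_eqMixin (copula R).
HB.instance Definition _ (R : realType) := gen_choiceMixin (copula R).

(* The uniform topology: the one induced on copulas by the space of functions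
   on the unit square with the topology of uniform convergence. *)
Definition copula_unif (R : realType) (C : copula R) :
  {uniform ({i01 R} * {i01 R}) -> R} := copula_fun C.

HB.instance Definition _ (R : realType) :=
  Uniform.copy (copula R) (initial_topology (@copula_unif R)).

Lemma copula_nbhsE (R : realType) (C : copula R) (P : set (copula R)) :
  nbhs C P <-> exists2 e : R, 0 < e &
    forall D : copula R, (forall x, `|C x - D x| < e) -> P D.
Proof.
split.
- move=> /(@nbhsP (copula R)) [E [F]].
  rewrite uniform_entourage => -[G] entG GF FE EP.
  move: entG; rewrite -entourage_ballE => -[e e0 eG].
  exists e => // D CD; apply: EP; apply/mem_set; apply: FE; apply: GF => x /= _ .
  by apply: (eG (C x, D x)); exact: CD.
- move=> [e e0 H]; apply/(@nbhsP (copula R)).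
  exists [set CD : copula R * copula R | forall x, `|CD.1 x - CD.2 x| < e]; last first.
    by move=> D /xsectionP /= ?; exact: H.
  exists [set fg : {uniform ({i01 R} * {i01 R}) -> R} * {uniform ({i01 R} * {i01 R}) -> R} | forall t, `|fg.1 t - fg.2 t| < e]; last by [].
  rewrite uniform_entourage; exists [set xy : R * R | `|xy.1 - xy.2| < e].
    by rewrite -entourage_ballE; exists e.
  by move=> fg /= h t; apply: h.
Qed.

Section copula_convex.
Context {R : realType}.
Implicit Types (p q r s : {i01 R}) (C D E : copula R).

Lemma copula_inj C D : (forall x, C x = D x) -> C = D.
Proof.
case: C D => [C HC] [D HD] /= /funext CD; subst D.
by congr Copula; exact: Prop_irrelevance.
Qed.

Lemma is_copula_avg p C D :
  is_copula (fun x => p%:num * C x + (1 - p%:num) * D x).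
Proof.
have p0 : 0 <= p%:num by [].
have p1 : 0 <= 1 - p%:num by rewrite subr_ge0.
case: C D => [C [C1 C2 C3 C4]] [D [D1 D2 D3 D4]]; split => /=.
- by move=> x; move: (C1 x) (D1 x) => /andP[? ?] /andP[? ?]; apply/andP; nra.
- by move=> u; have [-> ->] := C2 u; have [-> ->] := D2 u; rewrite !mulr0 addr0.
- move=> u; have [-> ->] := C3 u; have [-> ->] := D3 u.
  by rewrite -mulrDl subrKC mul1r.
- move=> u1 u2 v1 v2 u12 v12.
  have := addr_ge0 (mulr_ge0 p0 (C4 _ _ _ _ u12 v12))
                   (mulr_ge0 p1 (D4 _ _ _ _ u12 v12)).
  by lra.
Qed.

Definition copula_avg p C D : copula R := Copula (is_copula_avg p C D).

Lemma copula_avg1 C D : copula_avg 1%:i01 C D = C.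
Proof. by apply: copula_inj => x /=; ring. Qed.

Lemma copula_avgmm p C : copula_avg p C C = C.
Proof. by apply: copula_inj => x /=; ring. Qed.

Lemma copula_avgC p C D :
  copula_avg p C D = copula_avg (1 - p%:inum)%:i01 D C.
Proof. by apply: copula_inj => x /=; ring. Qed.

Lemma copula_avgA : convex_quasi_associative copula_avg.
Proof.
move=> p q r s C D E prs spq; apply: copula_inj => x /=.
have := ConvexQuasiAssoc.pq_sr prs spq; move: prs spq; rewrite /unstable.onem.
move: (p%:num) (q%:num) (r%:num) (s%:num) => P Q S T -> e1 e2.
by rewrite mulrDr !mulrA e2 -e1; ring.
Qed.

HB.instance Definition _ := isConvexSpace.Build R (copula R)
  copula_avg1 copula_avgmm copula_avgC copula_avgA.

End copula_convex.

(* The weight of [<| |>] bears on its left argument: [D <| t |> C] is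
   (1 - t) C + t D. *)
Lemma copula_convE (R : realType) (t : {i01 R}) (C D : copula R) x :
  (D <| t |> C) x = (1 - t%:num) * C x + t%:num * D x.
Proof. by rewrite addrC. Qed.

Definition degree_at_most_two (R : realType) (kappa : copula R -> R) : Prop :=
  forall C D : copula R, exists2 p : {poly R}, (size p <= 3)%N &
    forall t : {i01 R}, kappa (D <| t |> C) = p.[t%:num].

Lemma half_ge0 (R : realType) : 0 <= 2^-1 :> R.
Proof. by lra. Qed.

Lemma half_le1 (R : realType) : 2^-1 <= 1 :> R.
Proof. by lra. Qed.

Definition half (R : realType) : {i01 R} := Itv01 (half_ge0 R) (half_le1 R).

Lemma copula_halfE (R : realType) (C D : copula R) x :
  (C <| half R |> D) x = (C x + D x) / 2.
Proof. by rewrite copula_convE /=; lra. Qed.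

Definition polarization (R : realType) (kappa : copula R -> R)
    (C D : copula R) : R :=
  2 * kappa (C <| half R |> D) - (kappa C + kappa D) / 2.

Definition symmetric_map (R : realType) (b : copula R -> copula R -> R) : Prop :=
  forall C D, b C D = b D C.

Definition affine_map (R : realType) (f : copula R -> R) : Prop :=
  forall (t : {i01 R}) (C D : copula R),
    f (D <| t |> C) = (1 - t%:num) * f C + t%:num * f D.

Definition separately_affine (R : realType)
    (b : copula R -> copula R -> R) : Prop :=
  (forall D, affine_map (b^~ D)) /\ (forall C, affine_map (b C)).

Definition jointly_continuous (R : realType)
    (b : copula R -> copula R -> R) : Prop :=
  continuous (fun CD : copula R * copula R => b CD.1 CD.2).

(* Main.v *)
Require Import Defs.
From mathcomp Require Import all_boot all_order all_algebra.
From mathcomp Require Import all_classical all_reals all_analysis.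
From mathcomp Require Import ring lra.

Set Implicit Arguments.
Unset Strict Implicit.
Unset Printing Implicit Defensive.

Import Order.TTheory GRing.Theory Num.Theory.
Import numFieldNormedType.Exports.
Local Open Scope classical_set_scope.
Local Open Scope ring_scope.
Local Open Scope convex_scope.

(** A functional of degree at most two satisfies the quadratic interpolation
    formula (iii) on every segment, by comparing polynomials at t = 0, 1/2, 1.
    Affinity of the polarization amounts to kappa being a single quadratic
    polynomial on the line z = 1/2 of each triangle with barycentric coordinates
    (x, y, z).  Subtract from kappa the quadratic polynomial q with the same
    values at the vertices and edge midpoints; the difference g vanishes on the
    edges, hence is a multiple of s (1 - s) on each chord.  Going from
    (1/4, 1/4, 1/2) to (3/8, 3/8, 1/4) along a median and then to
    (1/4, 1/2, 1/4) along z = 1/4 gives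
    g (1/4, 1/2, 1/4) = 2/3 g (1/4, 1/4, 1/2).  By symmetry the converse
    relation holds too, so both values vanish, and then g = 0 on z = 1/2. *)

Lemma polarization_sym (R : realType) (kappa : copula R -> R) :
  symmetric_map (polarization kappa).
Proof.
move=> C D; rewrite /polarization [kappa C + _]addrC.
by congr (2 * kappa _ - _); apply: copula_inj => x; rewrite !copula_halfE addrC.
Qed.

Lemma polarization_diag (R : realType) (kappa : copula R -> R) (C : copula R) :
  polarization kappa C C = kappa C.
Proof. by rewrite /polarization convmm; lra. Qed.

Lemma continuous_copula_half (R : realType) :
  continuous (fun CD : copula R * copula R => CD.1 <| Defs.half R |> CD.2).
Proof.
move=> [C D] P /copula_nbhsE[e e0 eP].
(* If both arguments move by less than [e] in sup distance, so does their average; one radius serves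
   both factors. *)
exists ([set C' : copula R | forall x, `|C x - C' x| < e],
        [set D' : copula R | forall x, `|D x - D' x| < e]).
  by split; apply/copula_nbhsE; exists e.
move=> [C' D'] [/= CC' DD']; apply: eP => x; rewrite !copula_halfE.
have := CC' x; have := DD' x; rewrite !ltr_norml => /andP[? ?] /andP[? ?].
by apply/andP; split; lra.
Qed.

Lemma polarization_continuous (R : realType) (kappa : copula R -> R) :
  continuous kappa -> jointly_continuous (polarization kappa).
Proof.
move=> kappa_cont CD; rewrite /polarization.
have kappa_comp f : continuous f -> kappa (f x) @[x --> CD] --> kappa (f CD).
  move=> f_cont; exact: (continuous_comp (f_cont CD) (kappa_cont _)).
apply: cvgB; apply: cvgM; try exact: cvg_cst.
  by apply: kappa_comp; exact: continuous_copula_half.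
by apply: cvgD; apply: kappa_comp => ?; [exact: cvg_fst|exact: cvg_snd].
Qed.

(** This gives uniqueness: affinity in both slots and symmetry make the diagonal value at the
    midpoint of C and D equal to [(b C C + 2 * b C D + b D D) / 4], so the diagonal determines
    [b C D]. *)
Lemma separately_affine_polarization (R : realType)
    (b : copula R -> copula R -> R) :
  symmetric_map b -> separately_affine b -> polarization (fun C => b C C) = b.
Proof.
move=> bC [bl br]; apply/funext => C; apply/funext => D; rewrite /polarization.
by rewrite bl !br /= (bC D C); lra.
Qed.

Section degree_two.
Context {R : realType} {kappa : copula R -> R}.
Hypothesis kappa_deg : degree_at_most_two kappa.

Lemma degree_two_conv (C D : copula R) (t : {i01 R}) :
  kappa (D <| t |> C) =
    (1 - t%:num) ^+ 2 * kappa C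
    + 2 * t%:num * (1 - t%:num) * polarization kappa C D
    + t%:num ^+ 2 * kappa D.
Proof.
have [p p3 kp] := kappa_deg C D.
have pE x : p.[x] = p`_0 + p`_1 * x + p`_2 * x ^+ 2.
  by rewrite (horner_coef_wide _ p3) !big_ord_recl big_ord0 /= expr0 expr1; ring.
have k0 : kappa C = p.[0].
  rewrite -(kp 0%:i01); congr kappa; apply: copula_inj => x.
  by rewrite copula_convE /=; ring.
have k1 : kappa D = p.[1].
  rewrite -(kp 1%:i01); congr kappa; apply: copula_inj => x.
  by rewrite copula_convE /=; ring.
have kh := kp (Defs.half R).
(* Symmetry puts the midpoint in the order used by [kh]. *)
rewrite polarization_sym /polarization kp kh k0 k1 !pE /=.
by field.
Qed.

Let quarter : {i01 R}.
Proof. by apply: (@Itv01 R (4^-1)); lra. Defined.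

Let third : {i01 R}.
Proof. by apply: (@Itv01 R (3^-1)); lra. Defined.

Let mid (C D : copula R) := C <| Defs.half R |> D.

(* g (1/4, 1/4, 1/2) for the triangle with vertices C, D, E *)
Let excess (C D E : copula R) := kappa (mid (mid C D) E)
  - (kappa C + kappa D) / 16 - kappa E / 4 - polarization kappa C D / 8
  - (polarization kappa C E + polarization kappa D E) / 4.

(** The factor is 3/4 * 8/9: [s (1 - s)] at 1/4 against 1/2 on the median, then at 1/3 against 1/2
    on the chord z = 1/4. *)
Let excess_swap (C D E : copula R) : excess C E D = 2 / 3 * excess C D E.
Proof.
have midE : mid (E <| quarter |> C) (E <| quarter |> D) =
    E <| quarter |> mid C D.
  by apply: copula_inj => x; rewrite !copula_convE /=; field.
(* Both sides are the point (1/4, 1/2, 1/4), one third of the way along the chord from its end on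
   DE. *)
have eqM : (E <| quarter |> C) <| third |> (E <| quarter |> D) =
    mid (mid C E) D.
  by apply: copula_inj => x; rewrite !copula_convE /=; field.
have kCD := degree_two_conv D C (Defs.half R).
have kM := degree_two_conv E (mid C D) (Defs.half R).
have kP := degree_two_conv (mid C D) E quarter.
have kE1 := degree_two_conv C E quarter.
have kE2 := degree_two_conv D E quarter.
have kL := degree_two_conv (E <| quarter |> D) (E <| quarter |> C) third.
rewrite eqM [polarization kappa (E <| _ |> D) _]polarization_sym in kL.
rewrite {1}/polarization -/(mid (E <| quarter |> C) _) midE in kL.
rewrite (polarization_sym _ D C) -/(mid C D) in kCD.
rewrite (polarization_sym _ E) -/(mid _ E) in kM.
rewrite /excess (polarization_sym _ E D) /= in kCD kM kP kE1 kE2 kL *.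
move: kCD kM kP kE1 kE2 kL.
by lra.
Qed.

Let excess0 (C D E : copula R) : excess C D E = 0.
Proof. by have := excess_swap C D E; have := excess_swap C E D; lra. Qed.

(** Averaging with E carries the segment CD to the chord z = 1/2. There [excess0] fixes the value of
    [kappa] at the midpoint, and this makes the t^2 terms of the polarization cancel. *)
Lemma polarization_affinel (E : copula R) :
  affine_map ((polarization kappa)^~ E).
Proof.
move=> t C D.
have eqM : mid (D <| t |> C) E = mid D E <| t |> mid C E.
  by apply: copula_inj => x; rewrite !copula_convE /=; field.
have eqN : mid (mid C E) (mid D E) = mid (mid C D) E.
  by apply: copula_inj => x; rewrite !copula_convE /=; field.
have kT := degree_two_conv C D t.
have kL := degree_two_conv (mid C E) (mid D E) t.
rewrite -eqM {1}/polarization -/(mid (mid C E) _) eqN in kL.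
rewrite {1}/polarization -/(mid _ E) kL kT.
have /eqP := excess0 C D E.
rewrite /excess /polarization -!/(mid _ _) !subr_eq => /eqP ->.
by field.
Qed.

Lemma polarization_separately_affine : separately_affine (polarization kappa).
Proof.
split; first exact: polarization_affinel.
by move=> C t D E; rewrite !(polarization_sym _ C) polarization_affinel.
Qed.

End degree_two.

Theorem proposition3p2 (R : realType) (kappa : copula R -> R)
    (kappa_cont : continuous kappa) (kappa_deg : degree_at_most_two kappa) :
  [/\ [/\ jointly_continuous (polarization kappa),
          symmetric_map (polarization kappa) &
          separately_affine (polarization kappa)],
      (forall C : copula R, polarization kappa C C = kappa C),
      (forall (C D : copula R) (t : {i01 R}),
        kappa (D <| t |> C) =
          (1 - t%:num) ^+ 2 * kappa C
          + 2 * t%:num * (1 - t%:num) * polarization kappa C D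
          + t%:num ^+ 2 * kappa D) &
      unique (fun b : copula R -> copula R -> R =>
        [/\ symmetric_map b, separately_affine b &
            forall C : copula R, b C C = kappa C])
        (polarization kappa)].
Proof.
have aff := polarization_separately_affine kappa_deg.
split.
- by split => //; [exact: polarization_continuous|exact: polarization_sym].
- exact: polarization_diag.
- exact: degree_two_conv.
- split; first by split => //; [exact: polarization_sym|exact: polarization_diag].
  move=> b [bC baff /funext bk].
  by rewrite -(separately_affine_polarization bC baff) bk.
Qed.
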